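(* Let $n\ge1$, $0\le p\le n$ and $k\ge1$ be integers. In the unit $n$-cube $\square^n$, we have $Q_k^p(\square^n)=\mathcal{Q}^-_k\Lambda^p(\square^n)$.
   Context: $\square^n=[0,1]^n$ is the unit $n$-cube. $\mathcal{J}(n,k-1)$ is the set of multi-indices $\mathbf{k}=(k_1,\ldots,k_n)$ of integers with $0\le k_i\le k-1$. Each $\mathbf{k}\in\mathcal{J}(n,k-1)$ defines a map $\mathbf{k}_{k-1}:\square^n\to\square^n$, $\mathbf{k}_{k-1}(x_1,\ldots,x_n)=\frac{1}{k}(k_1+x_1,\ldots,k_n+x_n)$; the images $\mathbf{k}_{k-1}(\tau)$ of $p$-faces $\tau$ of $\square^n$ are the $k$th order small $p$-cubes. Let $\tau$ be a $p$-face of $\square^n$, let $x_{i_1},\ldots,x_{i_p}$ ($i_1<\ldots<i_p$) be the coordinates whose plane is parallel to $\tau$, and let $x_{i_{p+1}},\ldots,x_{i_n}$ be the other coordinates, which have constant values $y_{i_{p+1}},\ldots,y_{i_n}\in\{0,1\}$ on $\tau$. The lowest order cubical form of $\tau$ is $$\mathcal{W}\tau=\Big(\prod_{j=p+1}^n x_{i_j}^{y_{i_j}}(1-x_{i_j})^{1-y_{i_j}}\Big)\,\mathrm{d}x_{i_1}\wedge\ldots\wedge \mathrm{d}x_{i_p}.$$ The $k$th order cubical $p$-form corresponding to the small cube $\mathbf{k}_{k-1}(\tau)$ is $$w(\mathbf{k}_{k-1}(\tau))=\Big(\prod_{i=1}^n x_i^{k_i}(1-x_i)^{k-1-k_i}\Big)\mathcal{W}\tau,$$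 and $Q_k^p(\square^n)$ is the real linear span of $w(\mathbf{k}_{k-1}(\tau))$ over all $\mathbf{k}\in\mathcal{J}(n,k-1)$ and all $p$-faces $\tau$ of $\square^n$. $\mathcal{Q}^-_k\Lambda^p(\square^n)$ is the space of differential $p$-forms on $\square^n$ spanned by the forms $f\,\mathrm{d}x_{i_1}\wedge\ldots\wedge \mathrm{d}x_{i_p}$ with $1\le i_1<\ldots<i_p\le n$, where $f$ is a real polynomial in $x_1,\ldots,x_n$ of degree at most $k$ in each variable and of degree at most $k-1$ in each of the variables $x_{i_1},\ldots,x_{i_p}$. *)

(* Defs.v *)
From mathcomp Require Import all_boot all_order all_algebra.
From mathcomp Require Import boolp classical_sets reals.
From mathcomp Require Import mpoly.

Set Implicit Arguments.
Unset Strict Implicit.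
Unset Printing Implicit Defensive.

Import Order.TTheory GRing.Theory Num.Theory.
Local Open Scope ring_scope.

Definition cube (R : realType) (n : nat) : Type :=
  {x : 'rV[R]_n | [forall i, 0 <= x 0 i <= 1]}.

(* A p-form on the cube takes a point x and p tangent vectors of R^n, given as
   the rows of a p x n matrix. Alternation and multilinearity in the rows are
   not part of the type: they hold for [dx] below, hence on both spans. *)
Definition pform (R : realType) (n p : nat) : Type :=
  cube R n -> 'M[R]_(p, n) -> R.

(* Linear span, for equality of forms at all points of the cube. *)
Definition form_span (R : realType) (n p : nat) (G : set (pform R n p)) :
    set (pform R n p) :=
  fun w => exists (m : nat) (c : 'I_m -> R) (g : 'I_m -> pform R n p),
    (forall j, G (g j)) /\
    (forall x v, w x v = \sum_(j < m) c j * g j x v).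

(* A choice of p coordinates i_1 < ... < i_p. *)
Definition dirs (n p : nat) : Type := {I : {set 'I_n} | #|I| == p}.

Lemma dirs_size (n p : nat) (I : dirs n p) : size (enum (val I)) == p.
Proof. by rewrite -cardE (valP I). Qed.

(* [enum] on 'I_n lists in increasing order, so this is (i_1, ..., i_p). *)
Definition dirs_tuple (n p : nat) (I : dirs n p) : p.-tuple 'I_n :=
  Tuple (dirs_size I).

(* (dx_{i_1} /\ ... /\ dx_{i_p}) (v_1, ..., v_p) = det (dx_{i_b} (v_a))_{a, b};
   it is the constant 1 when p = 0. *)
Definition dx (R : realType) (n p : nat) (I : dirs n p) (v : 'M[R]_(p, n)) : R :=
  \det (\matrix_(a < p, b < p) v a (tnth (dirs_tuple I) b)).

(* The face {x | x_i = y whenever t i = Some y} of the cube, with true and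
   false standing for 1 and 0; it is parallel to the coordinates i such that
   t i = None. *)
Definition free_dirs (n : nat) (t : {ffun 'I_n -> option bool}) : {set 'I_n} :=
  [set i | t i == None]%SET.

Definition face (n p : nat) : Type :=
  {t : {ffun 'I_n -> option bool} | #|free_dirs t| == p}.

Definition face_dirs (n p : nat) (t : face n p) : dirs n p :=
  exist _ (free_dirs (val t)) (valP t).

(* The lowest order cubical form W t. *)
Definition lowest_form (R : realType) (n p : nat) (t : face n p) : pform R n p :=
  fun x v =>
    (\prod_(i < n) (if val t i is Some y
                    then val x 0 i ^+ y * (1 - val x 0 i) ^+ (1 - y)
                    else 1)) * dx (face_dirs t) v.

(* The form w(kk_{k-1}(t)) of the small cube kk_{k-1}(t), for kk in
   J(n, k-1), i.e. 0 <= kk i <= k - 1. *)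
Definition small_form (R : realType) (n p k : nat) (kk : {ffun 'I_n -> 'I_k})
    (t : face n p) : pform R n p :=
  fun x v =>
    (\prod_(i < n) (val x 0 i ^+ kk i * (1 - val x 0 i) ^+ (k - 1 - kk i))) *
    lowest_form t x v.

Definition Q_space (R : realType) (n p k : nat) : set (pform R n p) :=
  form_span (fun w => exists (kk : {ffun 'I_n -> 'I_k}) (t : face n p),
    w = small_form kk t).

Definition deg_bounded (R : realType) (n p k : nat) (I : dirs n p)
    (f : {mpoly R[n]}) : Prop :=
  forall m : 'X_{1..n}, m \in msupp f ->
    (forall i, (m i <= k)%N) /\ (forall i, i \in val I -> (m i <= k - 1)%N).

Definition Qminus_space (R : realType) (n p k : nat) : set (pform R n p) :=
  form_span (fun w => exists (I : dirs n p) (f : {mpoly R[n]}),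
    deg_bounded k I f /\ w = (fun x v => f.@[fun i => val x 0 i] * dx I v)).

Arguments Q_space : clear implicits.
Arguments Qminus_space : clear implicits.

(* Main.v *)
Require Import Defs.
From mathcomp Require Import all_boot all_order all_algebra.
From mathcomp Require Import boolp classical_sets reals.
From mathcomp Require Import mpoly.
From mathcomp Require Import zify.

(** Put [d i = k - 1] for the coordinates [i] whose differential occurs in
    [dx I], and [d i = k] for the others.  Up to the common factor [dx I], both
    spaces are tensor products over the coordinates of spaces of polynomials in
    one variable of degree at most [d i], written in two different bases:
    monomials for the space [Qminus_space], and Bernstein polynomials
    [x ^ a (1 - x) ^ (d i - a)] for the space [Q_space].

    For the second space this is seen by collecting the powers of one
    coordinate in a small form ([small_form_bernstein]): a coordinate parallel
    to the face gets no factor from the lowest order form and has degree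
    [k - 1], while a constant coordinate gets one more factor [x] or [1 - x],
    hence has degree [k].  Every Bernstein exponent [0 <= a <= d i] is
    reached in this way ([bernstein_small_form]).

    The two univariate bases are combinations of each other: a Bernstein
    polynomial is expanded by its coefficients, and a monomial by the binomial
    formula applied to [x ^ m (x + (1 - x)) ^ (d - m)] ([expX_bernstein]).
    Distributing a product of such sums turns a univariate change of basis in
    each coordinate into one for the forms ([product_form_span]), which gives
    both inclusions. *)

Set Implicit Arguments.
Unset Strict Implicit.
Unset Printing Implicit Defensive.

Import Order.TTheory GRing.Theory Num.Theory.
Local Open Scope ring_scope.

Section FormSpan.
Variables (R : realType) (n p : nat).
Implicit Types (G H : set (pform R n p)) (w : pform R n p).

Lemma pform_ext w w' : (forall x v, w x v = w' x v) -> w = w'.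
Proof. by move=> e; apply/funext => x; apply/funext => v. Qed.

Lemma form_span_gen G w : G w -> form_span G w.
Proof.
move=> Gw; exists 1%N, (fun=> 1), (fun=> w); split=> // x v.
by rewrite big_ord1 mul1r.
Qed.

Lemma form_span0 G : form_span G (fun _ _ => 0).
Proof.
exists 0%N, (fun=> 0), (fun=> (fun _ _ => 0)); split; first by case.
by move=> x v; rewrite big_ord0.
Qed.

Lemma form_spanZD G (c : R) w w' : form_span G w -> form_span G w' ->
  form_span G (fun x v => c * w x v + w' x v).
Proof.
move=> [m [a [g [Gg ew]]]] [m' [a' [g' [Gg' ew']]]].
exists (m + m')%N,
  (fun j => match split j with inl i => c * a i | inr i => a' i end),
  (fun j => match split j with inl i => g i | inr i => g' i end).
split=> [j|x v]; first by case: (split j).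
rewrite big_split_ord ew ew' mulr_sumr /=; congr (_ + _).
  by apply: eq_bigr => i _; rewrite (unsplitK (inl i)) mulrA.
by apply: eq_bigr => i _; rewrite (unsplitK (inr i)).
Qed.

Lemma form_span_sum G (T : eqType) (r : seq T) (P : pred T) (c : T -> R)
    (g : T -> pform R n p) :
  (forall i, i \in r -> P i -> form_span G (g i)) ->
  form_span G (fun x v => \sum_(i <- r | P i) c i * g i x v).
Proof.
elim: r => [|i r IHr] Gg.
  rewrite (_ : (fun _ _ => _) = (fun _ _ => 0)); first exact: form_span0.
  by apply: pform_ext => x v; rewrite big_nil.
have {}IHr := IHr (fun j jr => Gg j (mem_behead (s := i :: r) jr)).
case Pi: (P i).
  have := form_spanZD (c i) (Gg i (mem_head i r) Pi) IHr.
  by congr form_span; apply: pform_ext => x v; rewrite big_cons Pi.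
by move: IHr; congr form_span; apply: pform_ext => x v; rewrite big_cons Pi.
Qed.

Lemma form_span_sub G H : (forall w, G w -> form_span H w) ->
  forall w, form_span G w -> form_span H w.
Proof.
move=> GH w [m [c [g [Gg ew]]]].
have -> : w = (fun x v => \sum_(j < m) c j * g j x v) by exact: pform_ext.
by apply: form_span_sum => j _ _; exact/GH/Gg.
Qed.

End FormSpan.

Section Bernstein.
Variable R : realType.

(** Without the binomial factor of the usual Bernstein polynomials, as in the
    small forms. *)
Definition bernstein (d a : nat) : {poly R} := 'X^a * (1 - 'X) ^+ (d - a).

Lemma hornerE_bernstein d a (x : R) :
  (bernstein d a).[x] = x ^+ a * (1 - x) ^+ (d - a).
Proof. by rewrite /bernstein !hornerE. Qed.

Lemma size_bernstein d a : (a <= d)%N -> (size (bernstein d a) <= d.+1)%N.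
Proof.
move=> le_ad; apply: leq_trans (size_polyMleq _ _) _; rewrite size_polyXn.
have : (size ((1 - 'X : {poly R}) ^+ (d - a)) <= d - a + 1)%N.
  apply: leq_trans (size_poly_exp_leq _ _) _.
  by rewrite -opprB size_polyN size_XsubC mul1n addn1.
by move=> le_s; apply: leq_trans (leq_add (leqnn a) le_s) _; lia.
Qed.

(** The binomial formula for [x ^ m (x + (1 - x)) ^ (d - m)]; the binomial
    coefficient vanishes for the indices [j < m], so that the sum may range
    over the whole basis. *)
Lemma expX_bernstein d m : (m <= d)%N ->
  'X^m = \sum_(j < d.+1) 'C(d - m, d - j)%:R *: bernstein d j.
Proof.
move=> le_md.
(* The term of index [i] in the binomial formula is [bernstein d (d - i)]. *)
rewrite (reindex_inj rev_ord_inj) /=.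
have -> : 'X^m = 'X^m * ('X + (1 - 'X)) ^+ (d - m) :> {poly R}.
  by rewrite addrC subrK expr1n mulr1.
rewrite exprDn mulr_sumr.
rewrite (big_ord_widen d.+1
  (fun i => 'X^m * ('X^(d - m - i) * (1 - 'X) ^+ i *+ 'C(d - m, i)))) ?ltnS
  ?leq_subr // big_mkcond; apply: eq_bigr => i _ /=.
have le_id : (i <= d)%N by rewrite -ltnS.
rewrite subSS /bernstein (subKn le_id).
case: ltnP => hi; last by rewrite bin_small // scale0r.
rewrite scaler_nat mulrnAr mulrA -exprD; congr ('X^_ * _ *+ _); lia.
Qed.

End Bernstein.

Section ProductForm.
Variables (R : realType) (n p : nat).
Implicit Types (I : dirs n p) (u : 'I_n -> {poly R}).

Definition product_form I u : pform R n p :=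
  fun x v => (\prod_(i < n) (u i).[val x 0 i]) * dx I v.

(** Distributing the product over the coordinates: a form with univariate
    factors [u i] is a combination of the forms whose factors are taken in the
    families [b i], as soon as each [u i] is a combination of [b i].  The
    number of terms depends on [i]; the uniform bound [k] puts all the indices
    in one finite type, so that a choice of one term in each coordinate is a
    finite function. *)
Lemma product_form_span (G : set (pform R n p)) I u (k : nat)
    (d : 'I_n -> nat) (b : 'I_n -> nat -> {poly R}) (c : 'I_n -> nat -> R) :
  (forall i, d i <= k)%N ->
  (forall i, u i = \sum_(j < (d i).+1) c i j *: b i j) ->
  (forall e : 'I_n -> nat, (forall i, e i <= d i)%N ->
     form_span G (product_form I (fun i => b i (e i)))) ->
  form_span G (product_form I u).
Proof.
move=> dk ub Gb.
have -> : product_form I u =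
    (fun x v => \sum_(e in family (fun i (j : 'I_k.+1) => j < (d i).+1)%N)
       (\prod_i c i (e i)) * product_form I (fun i => b i (e i)) x v).
  apply: pform_ext => x v; rewrite /product_form.
  under eq_bigr => i _.
    rewrite ub (big_ord_widen k.+1 (fun j => c i j *: b i j)) ?ltnS ?dk //.
    rewrite horner_sum; under eq_bigr do rewrite hornerZ.
    over.
  rewrite (bigA_distr_big_dep (fun i (j : 'I_k.+1) => j < (d i).+1)%N).
  rewrite mulr_suml; apply: eq_bigr => e _.
  by rewrite big_split /= mulrA.
apply: form_span_sum => e _ /familyP de; apply: Gb => i.
exact: (de i).
Qed.

End ProductForm.

Section SmallForms.
Variables (R : realType) (n p k : nat).
Hypothesis hk : (1 <= k)%N.
Implicit Types (I : dirs n p).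

Definition var_degree I (i : 'I_n) : nat := (k - (i \in val I))%N.

Lemma var_degree_le I i : (var_degree I i <= k)%N.
Proof. exact: leq_subr. Qed.

Lemma small_form_bernstein (kk : {ffun 'I_n -> 'I_k}) (t : face n p) :
  small_form kk t = product_form (face_dirs t) (fun i =>
    bernstein R (var_degree (face_dirs t) i) (kk i + (val t i == Some true))).
Proof.
apply: pform_ext => x v; rewrite /small_form /lowest_form /product_form mulrA.
rewrite -big_split /=; congr (_ * _); apply: eq_bigr => i _.
rewrite hornerE_bernstein /var_degree /= inE.
have := ltn_ord (kk i); case: (val t i) => [[]|] /= lt_kk.
- rewrite expr0 mulr1 mulrAC -exprD.
  congr (_ ^+ _ * _ ^+ _); lia.
- rewrite expr0 mul1r -mulrA -exprD.
  congr (_ ^+ _ * _ ^+ _); lia.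
- rewrite mulr1; congr (_ ^+ _ * _ ^+ _); lia.
Qed.

(** A coordinate outside [I] of Bernstein exponent [k] must come from the last
    small cube and the value [1]; every smaller exponent is obtained with the
    value [0]. *)
Lemma bernstein_small_form I (e : 'I_n -> nat) :
  (forall i, e i <= var_degree I i)%N ->
  exists (kk : {ffun 'I_n -> 'I_k}) (t : face n p),
    product_form I (fun i => bernstein R (var_degree I i) (e i)) =
    small_form kk t.
Proof.
move=> de.
pose tf : {ffun 'I_n -> option bool} :=
  [ffun i => if i \in val I then None else Some (e i == k)].
have tfI : free_dirs tf = val I.
  by apply/setP => i; rewrite inE ffunE; case: ifP.
have tfp : #|free_dirs tf| == p by rewrite tfI (valP I).
have kkP i : ((if e i == k then k.-1 else e i) < k)%N.
  by have := de i; rewrite /var_degree; case: eqP; lia.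
pose t : face n p := exist _ tf tfp.
have tI : face_dirs t = I by exact: val_inj.
exists [ffun i => Ordinal (kkP i)], t.
rewrite small_form_bernstein tI; congr product_form; apply/funext => i.
congr bernstein; rewrite !ffunE /=; have := de i; rewrite /var_degree.
case: (i \in val I) => /=; last by case: eqVneq => //=; lia.
by case: eqP; lia.
Qed.

Lemma monomial_form_Qminus I (m : 'I_n -> nat) :
  (forall i, m i <= var_degree I i)%N ->
  Qminus_space R n p k (product_form I (fun i => 'X^(m i))).
Proof.
move=> dm; apply: form_span_gen; exists I, 'X_[[multinom m i | i < n]].
split=> [m'|].
  rewrite msuppX inE => /eqP ->; split=> i; rewrite mnmE.
    exact: leq_trans (dm i) (var_degree_le I i).
  by move=> iI; have := dm i; rewrite /var_degree iI.
apply: pform_ext => x v; rewrite mevalX; congr (_ * _).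
by apply: eq_bigr => i _; rewrite hornerXn mnmE.
Qed.

Lemma small_form_Qminus (kk : {ffun 'I_n -> 'I_k}) (t : face n p) :
  Qminus_space R n p k (small_form kk t).
Proof.
rewrite small_form_bernstein; set I := face_dirs t; set u := (u in product_form _ u).
apply: (@product_form_span _ _ _ _ _ _ k (var_degree I) (fun _ j => 'X^j)
  (fun i j => (u i)`_j)); first exact: var_degree_le; last first.
  exact: monomial_form_Qminus.
move=> i; rewrite -poly_def.
rewrite -[X in X = _](@take_poly_id _ (var_degree I i).+1) //.
apply: size_bernstein; rewrite /var_degree inE.
by have := ltn_ord (kk i); case: (val t i) => [[]|] /=; lia.
Qed.

Lemma monomial_form_Q I (m : 'I_n -> nat) :
  (forall i, m i <= var_degree I i)%N ->
  Q_space R n p k (product_form I (fun i => 'X^(m i))).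
Proof.
move=> dm.
apply: (@product_form_span _ _ _ _ _ _ k (var_degree I)
  (fun i j => bernstein R (var_degree I i) j)
  (fun i j => 'C(var_degree I i - m i, var_degree I i - j)%:R)).
- exact: var_degree_le.
- by move=> i; exact: expX_bernstein.
- move=> e /bernstein_small_form [kk [t ->]].
  by apply: form_span_gen; exists kk, t.
Qed.

Lemma poly_form_Q I (f : {mpoly R[n]}) : deg_bounded k I f ->
  Q_space R n p k (fun x v => f.@[fun i => val x 0 i] * dx I v).
Proof.
move=> df.
have -> : (fun (x : cube R n) v => f.@[fun i => val x 0 i] * dx I v) =
    (fun x v => \sum_(m <- msupp f) f@_m *
       product_form I (fun i => 'X^(m i)) x v).
  apply: pform_ext => x v; rewrite mevalE mulr_suml; apply: eq_bigr => m _.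
  rewrite -mulrA /product_form; congr (_ * (_ * _)).
  by apply: eq_bigr => i _; rewrite hornerXn.
apply: form_span_sum => m /df [mk mI] _; apply: monomial_form_Q => i.
by rewrite /var_degree; case: (boolP (i \in val I)) => [/mI|_] //; rewrite subn0.
Qed.

End SmallForms.

Theorem proposition2p5 (R : realType) (n p k : nat)
    (hn : (1 <= n)%N) (hp : (p <= n)%N) (hk : (1 <= k)%N) :
  Q_space R n p k = Qminus_space R n p k.
Proof.
apply/seteqP; split; apply: form_span_sub => w.
  by move=> [kk [t ->]]; exact: small_form_Qminus.
by move=> [I [f [df ->]]]; exact: poly_form_Q.
Qed.
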